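(* Suppose $p\neq2$, let $n\ge1$, $\alpha,\beta_1,\dots,\beta_n\in\widehat{\mathbb{F}_q^\times}$ with $\beta_i\neq\varepsilon$ for all $i$. For $\lambda_1,\dots,\lambda_n\in\mathbb{F}_q$ with $\sum_{i=1}^n\lambda_i\neq-1$, $$F_C^{(n)}\!\left({\alpha;\alpha\phi\atop\beta_1\phi,\dots,\beta_n\phi};\lambda_1^2,\dots,\lambda_n^2\right)=\overline{\alpha}^2\Big(1+\sum_{i=1}^n\lambda_i\Big)F_A^{(n)}\!\left({\alpha^2;\beta_1,\dots,\beta_n\atop\beta_1^2,\dots,\beta_n^2};\frac{2\lambda_1}{1+\sum_i\lambda_i},\dots,\frac{2\lambda_n}{1+\sum_i\lambda_i}\right).$$
   Context: $\mathbb{F}_q$ is a finite field with $q$ elements and characteristic $p$. $\widehat{\mathbb{F}_q^\times}$ is the group of multiplicative characters $\mathbb{F}_q^\times\to\overline{\mathbb{Q}}^\times$, $\varepsilon$ the trivial character, $\phi$ the quadratic character; every character $\eta$ (including $\varepsilon$) is extended by $\eta(0)=0$; $\overline{\eta}=\eta^{-1}$, and $\overline{\alpha}^2=\overline{\alpha}\,\overline{\alpha}$; $\delta(\eta)=1$ if $\eta=\varepsilon$, else $0$. $\psi$ is a fixed non-trivial additive character. $g(\eta)=-\sum_{x\in\mathbb{F}_q^\times}\psi(x)\eta(x)$, $g^\circ(\eta)=q^{\delta(\eta)}g(\eta)$, $(\alpha)_\nu=g(\alpha\nu)/g(\alpha)$, $(\alpha)^\circ_\nu=g^\circ(\alpha\nu)/g^\circ(\alpha)$.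 For $\lambda_i\in\mathbb{F}_q$, with sums over $\nu_1,\dots,\nu_n\in\widehat{\mathbb{F}_q^\times}$, $F_A^{(n)}\!\left({\alpha;\beta_1,\dots,\beta_n\atop\gamma_1,\dots,\gamma_n};\lambda\right)=\frac{1}{(1-q)^n}\sum\frac{(\alpha)_{\nu_1\cdots\nu_n}\prod_i(\beta_i)_{\nu_i}}{\prod_i(\gamma_i)^\circ_{\nu_i}(\varepsilon)^\circ_{\nu_i}}\prod_i\nu_i(\lambda_i)$, $F_C^{(n)}\!\left({\alpha;\beta\atop\gamma_1,\dots,\gamma_n};\lambda\right)=\frac{1}{(1-q)^n}\sum\frac{(\alpha)_{\nu_1\cdots\nu_n}(\beta)_{\nu_1\cdots\nu_n}}{\prod_i(\gamma_i)^\circ_{\nu_i}(\varepsilon)^\circ_{\nu_i}}\prod_i\nu_i(\lambda_i)$. *)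

(* Defs.v *)
From HB Require Import structures.
From mathcomp Require Import all_boot all_order all_algebra all_fingroup all_field all_character.
Set Implicit Arguments. Unset Strict Implicit. Unset Printing Implicit Defensive.
Import Order.TTheory GRing.Theory Num.Theory.
Local Open Scope ring_scope.

Section Defs.
Variable F : finFieldType.

Definition Fx : {group {unit F}} := [set: {unit F}]%G.

(* The character group \hat{F_q^x} is indexed by the irreducible characters
   of the (abelian) group F^x, i.e. all its homomorphisms into algC^x.
   A character is viewed as a function F -> algC, extended by 0 at 0. *)
Definition mchar (i : Iirr Fx) : F -> algC :=
  fun x => match insub x with Some u => 'chi_i u | None => 0 end.

Definition cmul (a b : F -> algC) : F -> algC := fun x => a x * b x.
Definition cinv (a : F -> algC) : F -> algC := fun x => (a x)^-1.
Definition cprod n (nu : 'I_n -> F -> algC) : F -> algC :=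
  fun x => \prod_(i < n) nu i x.
Definition eps : F -> algC := fun x => (x != 0)%:R.
Definition qphi : F -> algC :=
  fun x => if x == 0 then 0 else if [exists y : F, y ^+ 2 == x] then 1 else -1.
Definition delta (a : F -> algC) : nat := [forall x, a x == eps x].

Variable psi : F -> algC.

Definition gauss (a : F -> algC) : algC := - \sum_(x : F | x != 0) psi x * a x.
Definition gaussc (a : F -> algC) : algC := (#|F|%:R) ^+ delta a * gauss a.
Definition poch (a nu : F -> algC) : algC := gauss (cmul a nu) / gauss a.
Definition pochc (a nu : F -> algC) : algC := gaussc (cmul a nu) / gaussc a.

Definition FA n (a : F -> algC) (b c : 'I_n -> F -> algC) (lam : 'I_n -> F) : algC :=
  (1 - (#|F|%:R : algC)) ^- n *
  \sum_(nu : {ffun 'I_n -> Iirr Fx})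
     (poch a (cprod (fun i => mchar (nu i))) * \prod_(i < n) poch (b i) (mchar (nu i))
      / \prod_(i < n) (pochc (c i) (mchar (nu i)) * pochc eps (mchar (nu i)))
      * \prod_(i < n) mchar (nu i) (lam i)).

Definition FC n (a b : F -> algC) (c : 'I_n -> F -> algC) (lam : 'I_n -> F) : algC :=
  (1 - (#|F|%:R : algC)) ^- n *
  \sum_(nu : {ffun 'I_n -> Iirr Fx})
     (poch a (cprod (fun i => mchar (nu i))) * poch b (cprod (fun i => mchar (nu i)))
      / \prod_(i < n) (pochc (c i) (mchar (nu i)) * pochc eps (mchar (nu i)))
      * \prod_(i < n) mchar (nu i) (lam i)).

End Defs.

Definition is_nontriv_addchar (F : finFieldType) (psi : F -> algC) : Prop :=
  (forall x y, psi (x + y) = psi x * psi y) /\ (exists x, psi x != 1).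

(* Main.v *)
Require Import Defs.
From mathcomp Require Import all_boot all_order all_algebra all_fingroup all_field all_character.
From mathcomp Require Import cyclic ring.
From Stdlib Require Import FunctionalExtensionality.
Set Implicit Arguments. Unset Strict Implicit. Unset Printing Implicit Defensive.
Import GRing.Theory Num.Theory.
Local Open Scope ring_scope.

(* Writing the Gauss sum of [a nu_1 ... nu_n] as a sum over [x] separates the
   characters [nu_i], so that both Lauricella functions become
     - gauss(al^2)^-1 * \sum_x psi(x) al^2(x) \prod_i G_i(lam_i, x)
   (for F_C after applying the duplication formula to (al)_nu (al phi)_nu).
   For F_A, [G_i] is a finite 1F1; the substitution x -> (1 + \sum lam_i) x
   absorbs the prefactor and multiplies [G_i] by [psi (lam_i x)].  For F_C, [G_i]
   is a finite 0F1, and the two integrands agree by Kummer's second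
   transformation, which holds because both 1F1 and 0F1 are multiples of
   \sum_v be_i(1 - v^2) psi(t v), up to an additive character. *)

(** * Multiplicative characters: closure properties, orthogonality, the dual group *)

Section MultiplicativeCharacters.
Variable F : finFieldType.
Implicit Types (a b : F -> algC) (x y : F) (i j : Iirr (Fx F)).

(** A predicate on functions rather than on indices, so that products, inverses and [qphi] are
    characters without a choice of index; [mchar_surj] leads back to indices. *)
Definition is_mchar a := [/\ a 0 = 0, a 1 = 1 & {morph a : x y / x * y}].

Lemma is_mchar_neq0 a x : is_mchar a -> x != 0 -> a x != 0.
Proof.
case=> _ a1 aM x0; apply/eqP=> ax0; move/eqP: (oner_neq0 algC); apply.
by rewrite -a1 -(divff x0) aM ax0 mul0r.
Qed.

(** The case x = 0 rests on the convention 0^-1 = 0 in both fields. *)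
Lemma is_mcharV a x : is_mchar a -> a x^-1 = (a x)^-1.
Proof.
move=> ha; have [-> | x0] := eqVneq x 0.
  by case: ha => a0 _ _; rewrite !invr0 a0 invr0.
have ax0 := is_mchar_neq0 ha x0; apply: (mulfI ax0).
by case: ha => _ a1 aM; rewrite -aM !divff.
Qed.

Lemma is_mcharX a x n : is_mchar a -> a (x ^+ n) = a x ^+ n.
Proof. by case=> _ a1 aM; elim: n => [|n IHn]; rewrite ?expr0 // !exprS aM IHn. Qed.

Lemma is_mchar_N1sq a : is_mchar a -> a (-1) * a (-1) = 1.
Proof. by case=> _ a1 aM; rewrite -aM mulrNN mulr1. Qed.

Lemma is_mcharN1V a : is_mchar a -> (a (-1))^-1 = a (-1).
Proof. by move=> ha; rewrite -is_mcharV // invrN1. Qed.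

Lemma is_mchar_eps : is_mchar (@eps F).
Proof.
split; rewrite /eps ?eqxx ?oner_neq0 // => x y.
by rewrite mulf_eq0 negb_or -natrM mulnb.
Qed.

Lemma is_mchar_cmul a b : is_mchar a -> is_mchar b -> is_mchar (cmul a b).
Proof.
case=> a0 a1 aM [b0 b1 bM]; rewrite /cmul; split=> [||x y].
- by rewrite a0 mul0r.
- by rewrite a1 b1 mulr1.
- by rewrite aM bM mulrACA.
Qed.

Lemma is_mchar_cinv a : is_mchar a -> is_mchar (cinv a).
Proof.
case=> a0 a1 aM; rewrite /cinv; split=> [||x y].
- by rewrite a0 invr0.
- by rewrite a1 invr1.
- by rewrite aM invfM.
Qed.

(** Positivity of [n] matters: an empty product takes the value 1 at 0. *)
Lemma is_mchar_cprod n (nu : 'I_n -> F -> algC) : (0 < n)%N ->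
  (forall k, is_mchar (nu k)) -> is_mchar (Defs.cprod nu).
Proof.
case: n nu => // n nu _ h; rewrite /Defs.cprod; split=> [||x y].
- by rewrite big_ord_recl; case: (h ord0) => -> _ _; rewrite mul0r.
- by rewrite big1 // => i _; case: (h i).
- by rewrite -big_split; apply: eq_bigr => i _ /=; case: (h i).
Qed.

Lemma cmulC a b : cmul a b = cmul b a.
Proof. by apply: functional_extensionality => x; rewrite /cmul mulrC. Qed.

Lemma cmulA a b c : cmul a (cmul b c) = cmul (cmul a b) c.
Proof. by apply: functional_extensionality => x; rewrite /cmul mulrA. Qed.

Lemma cmul_epsr a : is_mchar a -> cmul a (@eps F) = a.
Proof.
case=> a0 _ _; apply: functional_extensionality => x.
by rewrite /cmul /eps; case: eqVneq => [->|]; rewrite ?a0 ?mul0r ?mulr1.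
Qed.

Lemma cmul_cinv a : is_mchar a -> cmul a (cinv a) = @eps F.
Proof.
move=> ha; apply: functional_extensionality => x; rewrite /cmul /cinv /eps.
case: (eqVneq x 0) => [->|x0] /=; last by rewrite divff ?is_mchar_neq0.
by case: ha => ->; rewrite mul0r.
Qed.

Lemma cinvK a : cinv (cinv a) = a.
Proof. by apply: functional_extensionality => x; rewrite /cinv invrK. Qed.

Lemma cinv_cmul a b : cinv (cmul a b) = cmul (cinv a) (cinv b).
Proof. by apply: functional_extensionality => x; rewrite /cinv /cmul invfM. Qed.

Lemma cinv_eps : cinv (@eps F) = @eps F.
Proof.
apply: functional_extensionality => x; rewrite /cinv /eps.
by case: (x != 0); rewrite ?invr1 ?invr0.
Qed.

Lemma sum_eps : \sum_x @eps F x = #|F|%:R - 1.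
Proof.
have -> : #|F|%:R = \sum_(x : F) 1 :> algC by rewrite sumr_const.
rewrite (bigD1 0) // [in RHS](bigD1 0) //= /eps eqxx add0r addrC addrK.
by apply: eq_bigr => x ->.
Qed.

(** For some nonzero y with [a y] different from 1, the substitution x -> y x permutes the terms,
    yet it multiplies the sum by [a y]. *)
Lemma sum_mchar a : is_mchar a -> a <> @eps F -> \sum_x a x = 0.
Proof.
move=> ha ane; have [y y0 ay] : exists2 y, y != 0 & a y != 1.
  case: (pickP [pred y | (y != 0) && (a y != 1)]) => [y /andP[]|h]; first by exists y.
  case: ane; apply: functional_extensionality => x; rewrite /eps.
  have := h x; rewrite /=; case: eqVneq => [-> _|_ /= /negbT].
    by case: ha.
  by rewrite negbK => /eqP.
have: (a y - 1) * \sum_x a x = 0.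
  rewrite mulrBl mul1r mulr_sumr [X in _ - X](reindex_inj (mulfI y0)) /=.
  by apply/eqP; rewrite subr_eq0; apply/eqP/eq_bigr => x _; case: ha.
by move/eqP; rewrite mulf_eq0 subr_eq0 (negbTE ay) => /eqP.
Qed.

Lemma abelian_Fx : abelian (Fx F).
Proof. exact: cyclic_abelian (field_unit_group_cyclic _). Qed.

Lemma lin_Fx i : 'chi_i \is a linear_char.
Proof. exact: (char_abelianP _ abelian_Fx). Qed.

Lemma mchar_unit i (u : {unit F}) : mchar i (val u) = 'chi_i u.
Proof. by rewrite /mchar valK. Qed.

Lemma mchar_is_mchar i : is_mchar (mchar i).
Proof.
have m0 : mchar i 0 = 0 by rewrite /mchar insubF // unitr0.
split=> //; first by rewrite -(@FinRing.val_unit1 F) mchar_unit lin_char1 ?lin_Fx.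
move=> x y; have [->|x0] := eqVneq x 0; first by rewrite mul0r m0 mul0r.
have [->|y0] := eqVneq y 0; first by rewrite mulr0 m0 mulr0.
rewrite -unitfE in x0; rewrite -unitfE in y0.
rewrite -[x](SubK {unit F} x0) -[y](SubK {unit F} y0) -FinRing.val_unitM !mchar_unit.
by rewrite lin_charM ?lin_Fx ?inE.
Qed.

(** Second orthogonality in the group of units: as the group is abelian, centralizers are full and
    classes are singletons. At x = 0 all terms vanish. *)
Lemma mchar_orth x y : y != 0 ->
  \sum_i mchar i x * (mchar i y)^-1 = (x == y)%:R * (#|F|%:R - 1).
Proof.
move=> y0; have [->|x0] := eqVneq x 0.
  rewrite eq_sym (negbTE y0) mul0r big1 // => i _.
  by case: (mchar_is_mchar i) => -> _ _; rewrite mul0r.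
rewrite -unitfE in y0; rewrite -unitfE in x0.
rewrite -[x](SubK {unit F} x0) -[y](SubK {unit F} y0).
set u := Sub x x0; set v := Sub y y0.
under eq_bigr do rewrite !mchar_unit -lin_charV ?lin_Fx ?inE // lin_charV_conj ?lin_Fx ?inE //.
rewrite second_orthogonality_relation ?inE //.
have -> : 'C_(Fx F)[u]%g = Fx F.
  by apply/setIidPl; rewrite sub_cent1 (subsetP abelian_Fx) ?inE.
have -> : (v ^: Fx F = [set v])%g.
  by apply/cent_classP; rewrite (subsetP abelian_Fx) ?inE.
rewrite inE -val_eqE /= card_finField_unit -subn1 natrB 1?ltnW ?finNzRing_gt1 //.
by case: (x == y); rewrite ?mul1r ?mul0r.
Qed.

Lemma mchar_inj : injective (@mchar F).
Proof.
move=> i j eqij; apply: irr_inj; apply/cfunP=> u.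
by rewrite -!mchar_unit eqij.
Qed.

Lemma card_sub1_neq0 : #|F|%:R - 1 != 0 :> algC.
Proof. by rewrite subr_eq0 pnatr_eq1 neq_ltn finNzRing_gt1 orbT. Qed.

Lemma mchar_funP a b : reflect (a = b) [forall x, a x == b x].
Proof.
by apply: (iffP eqfunP) => [h|->//]; apply: functional_extensionality.
Qed.

Lemma sum_mchar_index x : \sum_i mchar i x = (x == 1)%:R * (#|F|%:R - 1).
Proof.
rewrite -mchar_orth ?oner_neq0 //; apply: eq_bigr => i _.
by case: (mchar_is_mchar i) => _ -> _; rewrite invr1 mulr1.
Qed.

(* By orthogonality some [mchar i] has a nonzero inner product with [a], and
   then the character [mchar i / a] has a nonzero sum, hence is trivial. *)
Lemma mchar_surj a : is_mchar a -> exists i, mchar i = a.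
Proof.
move=> ha; have [i hi] : exists i, \sum_x mchar i x * (a x)^-1 != 0.
  apply/existsP; apply: contraT; rewrite negb_exists => /forallP h.
  have : \sum_i \sum_x mchar i x * (a x)^-1 = 0.
    by apply: big1 => i _; have := h i; rewrite negbK => /eqP.
  rewrite exchange_big /= (bigD1 1) //= [X in _ + X]big1 ?addr0 => [|x x1].
    rewrite -mulr_suml sum_mchar_index eqxx mul1r; case: ha => _ -> _.
    by rewrite invr1 mulr1 => /eqP; rewrite (negbTE card_sub1_neq0).
  by rewrite -mulr_suml sum_mchar_index (negbTE x1) !mul0r.
exists i; have hm := mchar_is_mchar i.
have hc := is_mchar_cmul hm (is_mchar_cinv ha).
have [e|/mchar_funP ne] := boolP [forall x, cmul (mchar i) (cinv a) x == @eps F x].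
  move/mchar_funP: e => e; rewrite -[LHS](cmul_epsr hm) -(cmul_cinv ha).
  by rewrite [cmul a _]cmulC cmulA e cmulC cmul_epsr.
by move: hi; rewrite (sum_mchar hc ne) eqxx.
Qed.

(** Multiplication by [a] permutes the dual group; [mchar_surj] provides the corresponding map on
    indices. *)
Lemma reindex_mchar a (f : (F -> algC) -> algC) : is_mchar a ->
  \sum_i f (mchar i) = \sum_i f (cmul (mchar i) a).
Proof.
move=> ha.
have [h hE] : exists h : Iirr (Fx F) -> Iirr (Fx F), forall i, mchar (h i) = cmul (mchar i) a.
  apply: (@fin_all_exists _ (fun=> Iirr (Fx F)) (fun i j => mchar j = cmul (mchar i) a)) => i.
  exact: mchar_surj (is_mchar_cmul (mchar_is_mchar i) ha).
have hI : injective h.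
  move=> i j eqh; apply: mchar_inj.
  have : cmul (cmul (mchar i) a) (cinv a) = cmul (cmul (mchar j) a) (cinv a).
    by rewrite -!hE eqh.
  by rewrite -!cmulA cmul_cinv // !cmul_epsr //; apply: mchar_is_mchar.
by rewrite (reindex_inj hI); apply: eq_bigr => i _; rewrite hE.
Qed.

End MultiplicativeCharacters.

(** * The quadratic character in odd characteristic *)

Section QuadraticCharacter.
Variable F : finFieldType.
Hypothesis two_neq0 : (2%:R : F) != 0.
Implicit Types (w x y : F).
Local Notation phi := (@qphi F).

Lemma qphi_sqr x : x != 0 -> phi (x ^+ 2) = 1.
Proof.
move=> x0; rewrite /qphi expf_eq0 /= (negbTE x0).
by case: existsP => // -[]; exists x.
Qed.

Lemma qphi_nonsq x : ~~ [exists y : F, y ^+ 2 == x] -> phi x = -1.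
Proof.
move=> nx; rewrite /qphi (negbTE nx); case: eqP nx => // ->.
by case/existsP; exists 0; rewrite expr0n.
Qed.

(* Both factors are odd powers of a generator of the cyclic group of units. *)
Lemma nonsq_mul x y : ~~ [exists z : F, z ^+ 2 == x] -> ~~ [exists z : F, z ^+ 2 == y] ->
  [exists z : F, z ^+ 2 == x * y].
Proof.
have /cyclicP[g gE] := field_unit_group_cyclic (Fx F).
have gen z : ~~ [exists t : F, t ^+ 2 == z] -> exists2 k, odd k & z = val g ^+ k.
  move=> nz; have z0 : z != 0.
    by apply: contra nz => /eqP ->; apply/existsP; exists 0; rewrite expr0n.
  rewrite -unitfE in z0; have : Sub z z0 \in <[g]>%g by rewrite -gE inE.
  case/cycleP=> k /(congr1 val); rewrite FinRing.val_unitX /= => zE.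
  exists k => //; apply: contraR nz => ek; apply/existsP; exists (val g ^+ k./2).
  by rewrite -exprM muln2 even_halfK // zE.
move=> /gen[k ok ->] /gen[l ol ->]; apply/existsP; exists (val g ^+ (k + l)./2).
by rewrite -exprM muln2 even_halfK ?exprD // oddD ok ol.
Qed.

Lemma qphi_sqM x y : [exists z : F, z ^+ 2 == x] -> phi (x * y) = phi x * phi y.
Proof.
case/existsP=> z /eqP <-; have [->|z0] := eqVneq z 0.
  by rewrite expr0n mul0r /qphi eqxx mul0r.
rewrite qphi_sqr // mul1r /qphi mulf_eq0 expf_eq0 /= (negbTE z0) /=.
suff -> : [exists t, t ^+ 2 == z ^+ 2 * y] = [exists t, t ^+ 2 == y] by [].
apply/existsP/existsP=> -[t /eqP tE]; last by exists (z * t); rewrite exprMn tE.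
by exists (t / z); rewrite expr_div_n tE mulrC mulKf // expf_neq0.
Qed.

Lemma is_mchar_qphi : is_mchar phi.
Proof.
split; first by rewrite /qphi eqxx.
  by rewrite -(expr1n F 2) qphi_sqr ?oner_neq0.
move=> x y; case: (boolP [exists z, z ^+ 2 == x]) => [/qphi_sqM //|nx].
case: (boolP [exists z, z ^+ 2 == y]) => [sy|ny]; first by rewrite mulrC qphi_sqM // mulrC.
have x0 : x != 0.
  by apply: contra nx => /eqP ->; apply/existsP; exists 0; rewrite expr0n.
have y0 : y != 0.
  by apply: contra ny => /eqP ->; apply/existsP; exists 0; rewrite expr0n.
rewrite (qphi_nonsq nx) (qphi_nonsq ny) mulrNN mulr1 /qphi (nonsq_mul nx ny).
by rewrite mulf_eq0 (negbTE x0) (negbTE y0).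
Qed.

Lemma cinv_qphi : cinv phi = phi.
Proof.
apply: functional_extensionality => x; rewrite /cinv /qphi.
by case: ifP => _; rewrite ?invr0 //; case: ifP => _; rewrite ?invr1 ?invrN1.
Qed.

Lemma oppr_neq x : x != 0 -> - x != x.
Proof.
move=> x0; rewrite eq_sym -subr_eq0 opprK -mulr2n -mulr_natl mulf_eq0 negb_or.
by rewrite two_neq0.
Qed.

Lemma qphi_neq_eps : phi <> @eps F.
Proof.
(* If phi were trivial, every element would be a square. A choice of square roots is then injective,
   hence onto, so 1 and -1 are both the chosen root of 1, which forces 1 = -1. *)
move=> e; have sq (x : F) : exists y, y ^+ 2 = x.
  suff /existsP[y /eqP] : [exists y, y ^+ 2 == x] by exists y.
  apply: contraT => nx; have := qphi_nonsq nx; rewrite e => m1.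
  have : (0 : algC) <= -1 by rewrite -m1 ler0n.
  by rewrite oppr_ge0 ler10.
have {sq}[g gE] := @fin_all_exists _ (fun=> F) (fun x y => y ^+ 2 = x) sq.
have gI : injective g by move=> x y gxy; rewrite -(gE x) -(gE y) gxy.
have [/codomP[u uE] /codomP[v vE]] := (injF_onto gI 1, injF_onto gI (-1)).
have /eqP := oppr_neq (oner_neq0 F); apply; rewrite {1}vE uE; congr g.
by rewrite -(gE u) -(gE v) -uE -vE sqrrN.
Qed.

(** [1 + phi w] counts the square roots of [w], including the single root of 0. *)
Lemma sum_sqr (f : F -> algC) : \sum_v f (v ^+ 2) = \sum_w f w * (1 + phi w).
Proof.
rewrite (partition_big (fun v : F => v ^+ 2) predT) //=.
apply: eq_bigr => w _; rewrite (eq_bigr (fun=> f w)); last by move=> v /eqP ->.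
have [->|w0] := eqVneq w 0.
  rewrite /qphi eqxx addr0 mulr1 (big_pred1 0) // => v.
  by rewrite expf_eq0.
have [/existsP[y /eqP yE]|nw] := boolP [exists y, y ^+ 2 == w]; last first.
  rewrite (qphi_nonsq nw) addrN mulr0 big_pred0 // => v.
  by apply: contraNF nw => vw; apply/existsP; exists v.
have y0 : y != 0 by apply: contraNneq w0 => y0; rewrite -yE y0 expr0n.
rewrite -yE qphi_sqr // (bigD1 y) //= (big_pred1 (- y)) ?mulrDr ?mulr1 // => v.
rewrite eqf_sqr /=; have [->|_] := eqVneq v y; last by rewrite andbT.
by rewrite andbF eq_sym (negbTE (oppr_neq y0)).
Qed.
End QuadraticCharacter.

(** * Gauss and Jacobi sums *)

Section GaussSums.
Variables (F : finFieldType) (psi : F -> algC).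
Hypothesis psiD : forall x y, psi (x + y) = psi x * psi y.
Hypothesis psi0 : psi 0 = 1.
Hypothesis psi_nontriv : exists x, psi x != 1.
Implicit Types (a b : F -> algC) (x y : F).
Local Notation g := (gauss psi).
Local Notation gc := (gaussc psi).
Local Notation q := (#|F|%:R : algC).
Local Notation one := (@eps F).

(** Taken without the sign built into [gauss], whence the minus sign in [jacobi_gauss]. *)
Definition jacobi a b : algC := \sum_x a x * b (1 - x).

Lemma card_neq0 : q != 0.
Proof. by rewrite pnatr_eq0 -lt0n ltnW ?finNzRing_gt1. Qed.

Lemma sum_psi : \sum_x psi x = 0.
Proof.
have [y y1] := psi_nontriv.
have: (psi y - 1) * \sum_x psi x = 0.
  rewrite mulrBl mul1r mulr_sumr [X in _ - X](reindex_inj (addrI y)) /=.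
  by apply/eqP; rewrite subr_eq0; apply/eqP/eq_bigr => x _; rewrite psiD.
by move/eqP; rewrite mulf_eq0 subr_eq0 (negbTE y1) => /eqP.
Qed.

Lemma gaussE a : is_mchar a -> g a = - \sum_x psi x * a x.
Proof. by case=> a0 _ _; rewrite /gauss [in RHS](bigD1 0) //= a0 mulr0 add0r. Qed.

Lemma gauss_eps : g one = 1.
Proof.
rewrite /gauss (eq_bigr psi); last by move=> x x0; rewrite /eps x0 mulr1.
have := sum_psi; rewrite (bigD1 0) //= psi0 => /eqP.
by rewrite addrC addr_eq0 => /eqP ->; rewrite opprK.
Qed.

Lemma gaussc_eps : gc one = q.
Proof.
rewrite /gaussc gauss_eps mulr1 /delta (introT (mchar_funP _ _)) //; exact: expr1.
Qed.

Lemma gaussc_neps a : a <> one -> gc a = g a.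
Proof. by move/mchar_funP/negbTE; rewrite /gaussc /delta => ->; rewrite mul1r. Qed.

(** The double sum is sorted by the sum s of the two variables: s = 0 gives the first term, and for
    s nonzero the rescaling x -> s x splits off [cmul a b s]. *)
Lemma gauss_mul a b : is_mchar a -> is_mchar b ->
  g a * g b = \sum_x a x * b (- x) - g (cmul a b) * jacobi a b.
Proof.
move=> ha hb; rewrite !gaussE //; last exact: is_mchar_cmul.
rewrite mulrNN mulNr opprK mulr_suml.
transitivity (\sum_x \sum_s psi s * (a x * b (s - x))).
  apply: eq_bigr => x _; rewrite mulr_sumr (reindex_inj (addIr (- x))) /=.
  by apply: eq_bigr => s _; rewrite mulrACA -psiD addrC subrK.
rewrite exchange_big (bigD1 0) //= psi0; congr (_ + _).
  by apply: eq_bigr => x _; rewrite mul1r sub0r.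
rewrite [in RHS](bigD1 0) //= {1}/cmul; case: (ha) => -> _ aM; case: (hb) => _ _ bM.
rewrite mul0r mulr0 add0r mulr_suml; apply: eq_bigr => s s0.
rewrite -mulr_sumr -mulrA; congr (_ * _); rewrite (reindex_inj (mulfI s0)) mulr_sumr /=.
apply: eq_bigr => x _; rewrite (_ : s - s * x = s * (1 - x)); last by rewrite mulrBr mulr1.
by rewrite aM bM /cmul mulrACA.
Qed.

Lemma sum_mulN a b : is_mchar b -> \sum_x a x * b (- x) = b (-1) * \sum_x cmul a b x.
Proof.
move=> [_ _ bM]; rewrite mulr_sumr; apply: eq_bigr => x _.
by rewrite -[- x]mulN1r bM /cmul mulrCA.
Qed.

(** For x nonzero the summand is b(1/x - 1), and 1/x - 1 takes every value except -1, so the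
    vanishing full sum of [b] leaves -b(-1). *)
Lemma jacobi_cinv b : is_mchar b -> b <> one -> jacobi (cinv b) b = - b (-1).
Proof.
move=> hb bne; rewrite /jacobi (bigD1 0) //= {1}/cinv.
case: (hb) => b0 b1 bM; rewrite b0 invr0 mul0r add0r.
have := sum_mchar hb bne; rewrite (reindex_inj (addIr (-1))) /= (bigD1 0) //= add0r.
move/eqP; rewrite addrC addr_eq0 => /eqP <-.
rewrite [RHS](reindex_inj invr_inj) /=; apply: eq_big => [x|x x0]; first by rewrite invr_eq0.
by rewrite /cinv -is_mcharV // -bM mulrBr mulr1 mulVf.
Qed.

Lemma gauss_cinv_neps b : is_mchar b -> b <> one -> g (cinv b) * g b = b (-1) * q.
Proof.
move=> hb bne; rewrite gauss_mul ?sum_mulN //; last exact: is_mchar_cinv.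
by rewrite jacobi_cinv // cmulC cmul_cinv // gauss_eps sum_eps; ring.
Qed.

(* The extra factor [q] in [gaussc] makes this hold also when [cmul a b] is trivial. *)
Lemma jacobi_gauss a b : is_mchar a -> is_mchar b -> b <> one ->
  jacobi a b * gc (cmul a b) = - (g a * g b).
Proof.
move=> ha hb bne; have [/mchar_funP e|/mchar_funP ne] := boolP [forall x, cmul a b x == one x].
  have -> : a = cinv b.
    rewrite -[LHS](cmul_epsr ha) -(cmul_cinv hb) cmulA e cmulC cmul_epsr //.
    exact: is_mchar_cinv.
  by rewrite gauss_cinv_neps // jacobi_cinv // cmulC cmul_cinv // gaussc_eps mulNr.
rewrite gaussc_neps // gauss_mul // sum_mulN // sum_mchar //; last exact: is_mchar_cmul.
by rewrite mulr0 sub0r opprK mulrC.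
Qed.

(** Reflection formula; [gaussc] in one factor supplies the [q] that would be missing for the
    trivial character. *)
Lemma gauss_cinv a : is_mchar a -> g a * gc (cinv a) = a (-1) * q.
Proof.
move=> ha; have [/mchar_funP ->|/mchar_funP ne] := boolP [forall x, a x == one x].
  by rewrite cinv_eps gauss_eps gaussc_eps /eps oppr_eq0 oner_eq0.
have ne' : cinv a <> one by move/(congr1 (@cinv F)); rewrite cinvK cinv_eps.
by rewrite gaussc_neps // mulrC gauss_cinv_neps.
Qed.

Lemma gauss_neq0 a : is_mchar a -> g a != 0.
Proof.
move=> ha; apply/eqP=> g0; have /eqP := gauss_cinv ha.
rewrite g0 mul0r eq_sym mulf_eq0 (negbTE card_neq0) orbF; apply/negP.
by apply: is_mchar_neq0; rewrite ?oppr_eq0 ?oner_eq0.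
Qed.

Lemma gaussc_neq0 a : is_mchar a -> gc a != 0.
Proof. by move=> ha; rewrite mulf_neq0 ?gauss_neq0 // expf_neq0 ?card_neq0. Qed.

Lemma gauss_cinvE a : is_mchar a -> g (cinv a) = a (-1) * q / gc a.
Proof.
move=> ha; apply: (mulIf (gaussc_neq0 ha)); rewrite divfK ?gaussc_neq0 //.
have := gauss_cinv (is_mchar_cinv ha); rewrite cinvK => ->.
by rewrite /cinv is_mcharN1V.
Qed.

(** * Character expansions and the one-variable functions *)

(** After the sums are exchanged, orthogonality over the characters selects x^k = y. Exponent 1
    expands [psi]; exponent 2 serves [bessel_integral]. *)
Lemma sum_gauss_expX_cinv k y : (0 < k)%N -> y != 0 ->
  \sum_i g (fun x => (mchar i (x ^+ k))^-1) * mchar i y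
  = (1 - q) * \sum_(v | v ^+ k == y) psi v.
Proof.
move=> k0 y0; transitivity (- \sum_i \sum_(x | x != 0)
    psi x * (mchar i y * (mchar i (x ^+ k))^-1)).
  rewrite -sumrN; apply: eq_bigr => i _; rewrite /gauss mulNr mulr_suml; congr (- _).
  by apply: eq_bigr => x _; rewrite mulrAC mulrA.
rewrite exchange_big /= [in RHS]big_mkcond -mulN1r !mulr_sumr [in RHS](bigD1 0) //=.
rewrite expr0n eqn0Ngt k0 eq_sym (negbTE y0) mulr0 add0r; apply: eq_bigr => x x0.
rewrite -mulr_sumr mchar_orth ?expf_neq0 // eq_sym.
by case: ifP => _ /=; ring.
Qed.

Lemma sum_gauss_cinv y : y != 0 ->
  \sum_i g (cinv (mchar i)) * mchar i y = (1 - q) * psi y.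
Proof. by move=> y0; rewrite (@sum_gauss_expX_cinv 1) // (big_pred1 y). Qed.

Lemma sum_gauss_sqr_cinv y : y != 0 ->
  \sum_i g (cinv (cmul (mchar i) (mchar i))) * mchar i y
  = (1 - q) * \sum_(v | v ^+ 2 == y) psi v.
Proof.
move=> y0; rewrite -sum_gauss_expX_cinv //; apply: eq_bigr => i _.
congr (g _ * _); apply: functional_extensionality => x.
by rewrite is_mcharX //; apply: mchar_is_mchar.
Qed.

Lemma pochc_eps a : is_mchar a -> pochc psi one a = gc a / q.
Proof. by move=> ha; rewrite /pochc cmulC cmul_epsr // gaussc_eps. Qed.

Lemma one_sub_card_neq0 : 1 - q != 0.
Proof. by rewrite -opprB oppr_eq0 card_sub1_neq0. Qed.

(** Finite exponential series, with [pochc psi one] as the factorial. In [sum_gauss_cinv] at -y,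
    reflection turns the Gauss sum of the inverse of nu into nu(-1) q / gc(nu), and the two signs
    nu(-1) cancel. *)
Lemma psi_expansion y : y != 0 ->
  psi (- y) = (1 - q)^-1 * \sum_i mchar i y / pochc psi one (mchar i).
Proof.
move=> y0; apply: (mulfI one_sub_card_neq0); rewrite mulVKf ?one_sub_card_neq0 //.
rewrite -sum_gauss_cinv ?oppr_eq0 //; apply: eq_bigr => i _.
have hi := mchar_is_mchar i; rewrite gauss_cinvE // pochc_eps // -[- y]mulN1r.
have m1 := is_mchar_N1sq hi; case: (hi) => _ _ ->.
rewrite invf_div -[mchar i y * _]mul1r -[X in _ = X * _]m1; ring.
Qed.

(** The trivial character only removes the term x = 0, equal to b(1) = 1, from a vanishing sum. *)
Lemma jacobi_epsl b : is_mchar b -> b <> one -> jacobi one b = -1.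
Proof.
move=> hb bne; have := sum_mchar hb bne; rewrite (reindex_inj (subrI 1)) /=.
rewrite (bigD1 0) //= subr0; case: hb => _ -> _ /eqP.
rewrite addrC addr_eq0 => /eqP <-; rewrite /jacobi (bigD1 0) //= {1}/eps eqxx mul0r add0r.
by apply: eq_bigr => x x0; rewrite /eps x0 mul1r.
Qed.

(** The finite 1F1(b; b^2; t), which is the factor of [FA] attached to one variable. *)
Definition kummer b t : algC := (1 - q)^-1 * \sum_i poch psi b (mchar i) /
  (pochc psi (cmul b b) (mchar i) * pochc psi one (mchar i)) * mchar i t.

(** The finite 0F1(; c; t). *)
Definition bessel c t : algC := (1 - q)^-1 * \sum_i
  (pochc psi c (mchar i) * pochc psi one (mchar i))^-1 * mchar i t.

(** Finite Euler integral of 1F1: once [psi] is expanded, the sum over u attached to nu is the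
    Jacobi sum of b nu and b. *)
Lemma kummer_integral b t : is_mchar b -> b <> one -> t != 0 ->
  \sum_u b u * b (1 - u) * psi (- (t * u)) = - (g b ^+ 2 / gc (cmul b b)) * kummer b t.
Proof.
move=> hb bne t0; transitivity ((1 - q)^-1 * \sum_i
   mchar i t / pochc psi one (mchar i) * jacobi (cmul b (mchar i)) b).
  under [in RHS]eq_bigr do rewrite mulr_sumr; rewrite exchange_big mulr_sumr /=.
  (* The expansion of [psi] fails at u = 0, but [b 0 = 0] removes that term. *)
  apply: eq_bigr => u _; have [->|u0] := eqVneq u 0.
    case: (hb) => b0 _ _; rewrite b0 !mul0r big1 ?mulr0 // => i _.
    by rewrite /cmul b0 !mul0r mulr0.
  rewrite psi_expansion ?mulf_neq0 // mulrCA; congr (_ * _); rewrite mulr_sumr.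
  apply: eq_bigr => i _; case: (mchar_is_mchar i) => _ _ ->; rewrite /cmul; ring.
rewrite /kummer mulrCA; congr (_ * _); rewrite mulr_sumr; apply: eq_bigr => i _.
have hi := mchar_is_mchar i; have hbi := is_mchar_cmul hb hi.
have J := jacobi_gauss hbi hb bne; have hbbi := is_mchar_cmul hbi hb.
have -> : jacobi (cmul b (mchar i)) b = 
    - (g (cmul b (mchar i)) * g b) / gc (cmul (cmul b (mchar i)) b).
  by rewrite -J mulfK ?gaussc_neq0.
rewrite /poch pochc_eps // /pochc.
have -> : cmul (cmul b (mchar i)) b = cmul (cmul b b) (mchar i).
  by rewrite -cmulA [cmul (mchar i) b]cmulC cmulA.
have h1 := gaussc_neq0 (is_mchar_cmul (is_mchar_cmul hb hb) hi).
have h2 := gaussc_neq0 (is_mchar_cmul hb hb); have h3 := gaussc_neq0 hi.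
have h4 := gauss_neq0 hb; have h5 := card_neq0.
by field; rewrite h1 h2 h3 h4 h5.
Qed.

(** * Duplication formulas and Kummer's second transformation *)

Section Duplication.
Hypothesis two_neq0 : (2%:R : F) != 0.
Local Notation phi := (@qphi F).

Lemma four_neq0 : (4%:R : F) != 0.
Proof. by rewrite (natrM _ 2 2) mulf_neq0. Qed.

(** In [sum_sqr] the summand 1 contributes the full sum of [b], which vanishes. *)
Lemma sum_one_sub_sqr b : is_mchar b -> b <> one ->
  \sum_v b (1 - v ^+ 2) = jacobi phi b.
Proof.
move=> hb bne; rewrite (sum_sqr two_neq0 (fun w => b (1 - w))).
under eq_bigr do rewrite mulrDr mulr1; rewrite big_split /= [X in X + _]( _ : _ = 0).
  by rewrite add0r; apply: eq_bigr => x _; rewrite mulrC.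
rewrite -[RHS](sum_mchar hb bne) [RHS](reindex_inj (subrI 1)) /=.
by apply: eq_bigr.
Qed.

(* Substitution u = (1 + v) / 2, for which 4 u (1 - u) = 1 - v^2. *)
Lemma sum_mul_one_sub b (f : F -> algC) : is_mchar b ->
  \sum_u b u * b (1 - u) * f u = (b 4%:R)^-1 * \sum_v b (1 - v ^+ 2) * f ((1 + v) / 2%:R).
Proof.
move=> hb; have i2 : 2%:R^-1 != 0 :> F by rewrite invr_eq0.
rewrite (reindex_inj (mulIf i2)) (reindex_inj (addrI 1)) /= mulr_sumr.
apply: eq_bigr => v _; rewrite mulrA; congr (_ * _).
case: (hb) => _ _ bM; rewrite -bM -is_mcharV // -bM; congr b.
by field; rewrite two_neq0 four_neq0.
Qed.

(** Hasse-Davenport product formula for 2: [sum_mul_one_sub] shows that the Jacobi sum of b and b is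
    b(4)^-1 times that of phi and b, and both are quotients of Gauss sums. *)
Lemma gauss_duplication_c b : is_mchar b ->
  gc b * gc (cmul b phi) = (b 4%:R)^-1 * g phi * gc (cmul b b).
Proof.
move=> hb; have hphi := is_mchar_qphi F; have pne := qphi_neq_eps two_neq0.
(* [jacobi_gauss] asks for a nontrivial [b], so the trivial character is checked directly. *)
have [/mchar_funP ->|/mchar_funP ne] := boolP [forall x, b x == one x].
  rewrite [cmul one phi]cmulC !cmul_epsr //; last exact: is_mchar_eps.
  by rewrite gaussc_eps gaussc_neps // /eps four_neq0 invr1 mul1r mulrC.
apply: (mulfI (gauss_neq0 hb)); rewrite (gaussc_neps ne).
have J1 := jacobi_gauss hb hb ne; have J2 := jacobi_gauss hphi hb ne.
have : jacobi b b = (b 4%:R)^-1 * jacobi phi b.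
  rewrite -sum_one_sub_sqr //.
  transitivity (\sum_u b u * b (1 - u) * 1); first by apply: eq_bigr => x _; rewrite mulr1.
  by rewrite sum_mul_one_sub //; under [in LHS]eq_bigr do rewrite mulr1.
move=> J; rewrite J in J1; rewrite [cmul phi b]cmulC in J2.
have -> : g b * (g b * gc (cmul b phi)) = (g b * g b) * gc (cmul b phi) by ring.
rewrite -[g b * g b]opprK -J1.
have -> : g b * ((b 4%:R)^-1 * g phi * gc (cmul b b)) = 
  (b 4%:R)^-1 * (g phi * g b) * gc (cmul b b) by ring.
by rewrite -[g phi * g b]opprK -J2; ring.
Qed.

Lemma sqr_gauss_qphi : g phi ^+ 2 = phi (-1) * q.
Proof.
have := gauss_cinv (is_mchar_qphi F); rewrite cinv_qphi gaussc_neps //.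
exact: qphi_neq_eps.
Qed.

(** Follows from [gauss_duplication_c] at the inverse character, because reflection relates [gauss]
    of a character to [gaussc] of its inverse. *)
Lemma gauss_duplication a : is_mchar a ->
  g a * g (cmul a phi) = (a 4%:R)^-1 * g phi * g (cmul a a).
Proof.
move=> ha; have hphi := is_mchar_qphi F; have pne := qphi_neq_eps two_neq0.

have hV := is_mchar_cinv ha.
have eV : cmul (cinv a) phi = cinv (cmul a phi) by rewrite cinv_cmul cinv_qphi.
have := gauss_duplication_c hV; rewrite eV -cinv_cmul {2}/cinv invrK => D.
have hap := is_mchar_cmul ha hphi; have haa := is_mchar_cmul ha ha.
have G1 := gauss_cinv ha; have G2 := gauss_cinv hap; have G3 := gauss_cinv haa.
have a40 : a 4%:R != 0 by apply: is_mchar_neq0 => //; apply: four_neq0.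
have P0 := gaussc_neq0 hV; have Q0 := gaussc_neq0 (is_mchar_cinv hap).
apply: (mulIf (mulf_neq0 P0 Q0)); rewrite mulrACA G1 G2 D /cmul.
transitivity (g phi ^+ 2 * (g (cmul a a) * gc (cinv (cmul a a)))).
  by rewrite sqr_gauss_qphi G3 /cmul (is_mchar_N1sq ha) -[phi (-1)]mul1r -(is_mchar_N1sq ha); ring.
by field.
Qed.

(* The factor [gauss nu / gaussc nu] is 1 unless [nu] is trivial. *)
Lemma gauss_sqr_cinv_jacobi nu b : is_mchar nu -> is_mchar b -> b <> one ->
  g (cinv (cmul nu nu)) * jacobi nu b =
  - (q ^+ 2 * phi (-1) * g b / g phi) / (nu 4%:R * gc (cmul b nu) * gc (cmul nu phi))
  * (g nu / gc nu).
Proof.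
move=> hn hb bne; have hphi := is_mchar_qphi F.
have hnp := is_mchar_cmul hn hphi; have hnn := is_mchar_cmul hn hn.
have hbn := is_mchar_cmul hb hn.
have n40 : nu 4%:R != 0 by apply: is_mchar_neq0 => //; apply: four_neq0.
have -> : jacobi nu b = - (g nu * g b) / gc (cmul b nu).
  by rewrite -(jacobi_gauss hn hb bne) [cmul nu b]cmulC mulfK ?gaussc_neq0.
rewrite gauss_cinvE // {1}/cmul (is_mchar_N1sq hn) mul1r.
have E : gc (cmul nu nu) = gc nu * gc (cmul nu phi) * nu 4%:R / g phi.
  by rewrite gauss_duplication_c //; field; rewrite n40 gauss_neq0.
rewrite E; have S : phi (-1) * q = g phi ^+ 2 by rewrite sqr_gauss_qphi.
have g0 := gauss_neq0 hphi; have h1 := gaussc_neq0 hn; have h2 := gaussc_neq0 hnp.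
have h3 := gaussc_neq0 hbn.
(* The factor phi(-1) q is isolated and traded for the square of the Gauss sum of phi; what remains
   is a rational identity. *)
have -> : q ^+ 2 * phi (-1) * g b / g phi = q * (phi (-1) * q) * g b / g phi by ring.
rewrite S; field.
by rewrite n40 g0 h1 h2 h3.
Qed.

(** Finite Poisson integral of a Bessel function: the nonzero v are grouped by v^2, and
    [sum_gauss_sqr_cinv] expands each group into characters. *)
Lemma bessel_integral b t : is_mchar b -> b <> one -> t != 0 ->
  \sum_v b (1 - v ^+ 2) * psi (t * v)
  = jacobi phi b * bessel (cmul b phi) (t ^+ 2 / 4%:R).
Proof.
move=> hb bne t0; have hphi := is_mchar_qphi F; case: (hb) => b0 b1 bM.
have expand : \sum_v b (1 - v ^+ 2) * psi (t * v) =
    1 + (1 - q)^-1 * \sum_i g (cinv (cmul (mchar i) (mchar i))) * jacobi (mchar i) b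
                             * mchar i (t ^+ 2).
  rewrite (bigD1 0) //= expr0n subr0 b1 mulr0 psi0 mul1r; congr (_ + _).
  transitivity (\sum_(w | w != 0) b (1 - w) * \sum_(v | v ^+ 2 == t ^+ 2 * w) psi v).
    rewrite (partition_big (fun v : F => v ^+ 2) (fun w => w != 0)) => [|v]; last first.
      by rewrite expf_eq0.
    apply: eq_bigr => w w0; rewrite [in RHS](reindex_inj (mulfI t0)) mulr_sumr /=.
    apply: eq_big => v; first last.
      by case/andP=> _ /eqP ->.
    rewrite exprMn (inj_eq (mulfI _)) ?expf_neq0 //.
    by have [->|//] := eqVneq v 0; rewrite expr0n eq_sym (negbTE w0).
  transitivity (\sum_w b (1 - w) * ((1 - q)^-1 * 
     \sum_i g (cinv (cmul (mchar i) (mchar i))) * mchar i (t ^+ 2 * w))).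
    (* The term w = 0 can be included because every character vanishes there; this completes the
       Jacobi sums. *)
    rewrite [in RHS](bigD1 0) //= mulr0 [X in _^-1 * X]big1 => [|i _]; last first.
      by case: (mchar_is_mchar i) => -> _ _; rewrite mulr0.
    rewrite !mulr0 add0r; apply: eq_bigr => w w0; congr (_ * _).
    rewrite sum_gauss_sqr_cinv ?mulf_neq0 ?expf_neq0 // mulKf //.
    exact: one_sub_card_neq0.
  under [in LHS]eq_bigr do rewrite mulrCA mulr_sumr.
  rewrite -mulr_sumr exchange_big /=; congr (_ * _); apply: eq_bigr => i _.
  rewrite /jacobi -mulrA mulr_suml !mulr_sumr; apply: eq_bigr => w _.
  by case: (mchar_is_mchar i) => _ _ ->; ring.
pose X nu := - (q ^+ 2 * phi (-1) * g b / g phi) /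
                (nu (4%:R : F) * gc (cmul b nu) * gc (cmul nu phi)) * nu (t ^+ 2).
(* At the trivial character the true term is -1 whereas [X] is -q. The difference q - 1, divided by
   1 - q, cancels the 1 contributed by v = 0. *)
have trivial_correction : \sum_i g (cinv (cmul (mchar i) (mchar i))) * jacobi (mchar i) b
    * mchar i (t ^+ 2) = \sum_i X (mchar i) + (q - 1).
  have [i0 i0E] := mchar_surj (is_mchar_eps F).
  rewrite (bigD1 i0) // [in RHS](bigD1 i0) //= [RHS]addrAC; congr (_ + _); last first.
    apply: eq_bigr => i ine; have hi := mchar_is_mchar i.
    have ne : mchar i <> one by rewrite -i0E => /mchar_inj e; rewrite e eqxx in ine.
    by rewrite gauss_sqr_cinv_jacobi // (gaussc_neps ne) divff ?gauss_neq0 // mulr1.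
  rewrite i0E jacobi_epsl // cmul_epsr; last exact: is_mchar_eps.
  rewrite cinv_eps gauss_eps /X cmul_epsr // [cmul one phi]cmulC cmul_epsr //.
  rewrite /eps expf_eq0 /= (negbTE t0) four_neq0 /= !gaussc_neps //; last exact: qphi_neq_eps.
  have h1 := gauss_neq0 hphi; have h2 := gauss_neq0 hb.
  have -> : q ^+ 2 * phi (-1) * g b / g phi = q * (phi (-1) * q) * g b / g phi by ring.
  by rewrite -sqr_gauss_qphi; field; rewrite h1 h2.
rewrite expand trivial_correction mulrDr -[q - 1]opprB mulrN mulVf ?one_sub_card_neq0 //.
(* Shifting nu by phi turns the factors at b nu and nu phi into factors at (b phi) nu and nu, as in
   the denominator of [bessel]. *)
rewrite addrCA addrN addr0 (reindex_mchar X hphi) /bessel mulrCA; congr (_ * _).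
rewrite mulr_sumr; apply: eq_bigr => i _; have hi := mchar_is_mchar i.
have hbp := is_mchar_cmul hb hphi.
have -> : jacobi phi b = - (g phi * g b) / gc (cmul b phi).
  by rewrite -(jacobi_gauss hphi hb bne) [cmul phi b]cmulC mulfK ?gaussc_neq0.
rewrite pochc_eps // /pochc /X -cmulA.
have -> : cmul phi phi = one by rewrite -{2}(cinv_qphi F) cmul_cinv.
rewrite cmul_epsr // cmulA.
have -> : cmul (cmul b (mchar i)) phi = cmul (cmul b phi) (mchar i).
  by rewrite -!cmulA [cmul phi _]cmulC.
have phi4 : phi 4%:R = 1 by rewrite (natrM _ 2 2) -expr2 qphi_sqr.
have phit : phi (t ^+ 2) = 1 by rewrite qphi_sqr.
rewrite [cmul (mchar i) phi (t ^+ 2)]/cmul [cmul (mchar i) phi 4%:R]/cmul.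
rewrite phi4 phit !mulr1; case: (hi) => _ _ hM; rewrite (hM (t ^+ 2) 4%:R^-1) (is_mcharV _ hi).
have n40 : mchar i 4%:R != 0 by apply: is_mchar_neq0 => //; apply: four_neq0.
have h1 := gauss_neq0 hphi; have h2 := gaussc_neq0 hbp; have h3 := gaussc_neq0 hi.
have h4 := gaussc_neq0 (is_mchar_cmul hbp hi); have h5 := card_neq0.
have -> : q ^+ 2 * phi (-1) * g b / g phi = q * (phi (-1) * q) * g b / g phi by ring.
rewrite -sqr_gauss_qphi; field.
by rewrite n40 h1 h2 h3 h4 h5.
Qed.

(* Finite field analogue of Kummer's second transformation
   e^{-t} 1F1(b; 2b; 2t) = 0F1(; b + 1/2; t^2 / 4). *)
Lemma kummer_bessel b t : is_mchar b -> b <> one ->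
  psi t * kummer b (2%:R * t) = bessel (cmul b phi) (t ^+ 2 / 4%:R).
Proof.
move=> hb bne; have hphi := is_mchar_qphi F; have [->|t0] := eqVneq t 0.
  (* Unlike the classical series, both functions vanish at 0, since all characters do. *)
  rewrite expr0n mul0r mulr0 /kummer /bessel !big1 ?mulr0 // => i _;
  by case: (mchar_is_mchar i) => -> _ _; rewrite mulr0.
have t20 : 2%:R * t != 0 by rewrite mulf_neq0.
have I := kummer_integral hb bne t20.
(* Up to a constant and the factor psi(-t), the integral becomes the Bessel integral at -t. *)
rewrite (sum_mul_one_sub (fun u => psi (- (2%:R * t * u)))) // in I.
have E : \sum_v b (1 - v ^+ 2) * psi (- (2%:R * t * ((1 + v) / 2%:R)))
    = psi (- t) * \sum_v b (1 - v ^+ 2) * psi (- t * v).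
  rewrite mulr_sumr; apply: eq_bigr => v _; rewrite [RHS]mulrCA -psiD; congr (_ * psi _).
  by field.
rewrite E bessel_integral ?oppr_eq0 // sqrrN in I.
have hbp := is_mchar_cmul hb hphi.
have J : jacobi phi b = - (g phi * g b) / gc (cmul b phi).
  by rewrite -(jacobi_gauss hphi hb bne) [cmul phi b]cmulC mulfK ?gaussc_neq0.
have D := gauss_duplication_c hb; rewrite (gaussc_neps bne) in D.
have h1 := gauss_neq0 hphi; have h2 := gaussc_neq0 hbp; have h3 := gauss_neq0 hb.
have h4 := gaussc_neq0 (is_mchar_cmul hb hb).
have b40 : b 4%:R != 0 by apply: is_mchar_neq0 => //; apply: four_neq0.
have Dg : gc (cmul b b) = g b * gc (cmul b phi) * b 4%:R / g phi.
  by rewrite D; field; rewrite b40 h1.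
have pp : psi t * psi (- t) = 1 by rewrite -psiD addrN.
set K := kummer _ _ in I *; set B := bessel _ _ in I *.
have -> : K = psi (- t) * B; last by rewrite mulrA pp mul1r.
have c0 : - (g b ^+ 2 / gc (cmul b b)) != 0 by rewrite oppr_eq0 mulf_neq0 ?expf_neq0 ?invr_eq0.
(* By duplication, both constants equal -g(b) g(phi) / (b(4) gc(b phi)). *)
apply: (mulfI c0); rewrite -I J Dg; field.
by rewrite b40 h1 h2 h3.
Qed.

(** Quotient of the duplication formulas at a nu and at a. The square of nu is written nu(x^2) to
    fit [lauricella_integral] with [h] the squaring map. *)
Lemma poch_duplication a nu : is_mchar a -> is_mchar nu ->
  poch psi a nu * poch psi (cmul a phi) nu
  = (nu 4%:R)^-1 * poch psi (cmul a a) (fun x => nu (x ^+ 2)).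
Proof.
move=> ha hn; have hphi := is_mchar_qphi F; have han := is_mchar_cmul ha hn.
have hap := is_mchar_cmul ha hphi; have haa := is_mchar_cmul ha ha.
rewrite /poch mulf_div gauss_duplication //.
have -> : cmul (cmul a phi) nu = cmul (cmul a nu) phi.
  by rewrite -!cmulA [cmul nu _]cmulC.
have -> : cmul (cmul a a) (fun x => nu (x ^+ 2)) = cmul (cmul a nu) (cmul a nu).
  apply: functional_extensionality => x; rewrite /cmul is_mcharX //; ring.
rewrite gauss_duplication //.
have four (c : F -> algC) : is_mchar c -> c 4%:R != 0.
  by move=> hc; apply: is_mchar_neq0 => //; apply: four_neq0.
rewrite {1}/cmul; field.
by rewrite !four // !gauss_neq0.
Qed.

End Duplication.

(** * Integral representations of the Lauricella functions *)

(** Once the Gauss sum is opened, the summand is a product over i, so the sum over tuples factors.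
    [h] is the identity for [FA] and squaring for [FC]; [D] holds the other coefficients. *)
Lemma lauricella_integral n a (h : F -> F) (D : 'I_n -> (F -> algC) -> algC) (mu : 'I_n -> F) :
  (1 - q) ^- n * \sum_(nu : {ffun 'I_n -> Iirr (Fx F)})
    (poch psi a (fun x => Defs.cprod (fun i => mchar (nu i)) (h x))
     * \prod_i (D i (mchar (nu i)) * mchar (nu i) (mu i)))
  = - (g a)^-1 * \sum_(x | x != 0) psi x * a x *
      \prod_i ((1 - q)^-1 * \sum_j D i (mchar j) * mchar j (mu i * h x)).
Proof.
transitivity ((1 - q) ^- n * (- (g a)^-1 * \sum_(x | x != 0) psi x * a x *
    \sum_(nu : {ffun 'I_n -> Iirr (Fx F)})
      \prod_i (D i (mchar (nu i)) * mchar (nu i) (mu i * h x)))); last first.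
  rewrite mulrCA; congr (_ * _); rewrite mulr_sumr; apply: eq_bigr => x _.
  rewrite mulrCA -(bigA_distr_bigA (fun i j => D i (mchar j) * mchar j (mu i * h x))).
  rewrite big_split /= prodr_const card_ord.
  by rewrite exprVn.
congr (_ * _); under [in RHS]eq_bigr do rewrite mulr_sumr.
rewrite exchange_big mulr_sumr /=; apply: eq_bigr => nu _.
rewrite /poch {1}/gauss [- _ / _]mulrC mulrN -mulNr -mulrA; congr (_ * _).
rewrite mulr_suml; apply: eq_bigr => x _; rewrite /cmul /Defs.cprod -!mulrA.
do 2! congr (_ * _); rewrite -big_split; apply: eq_bigr => i _ /=.
by case: (mchar_is_mchar (nu i)) => _ _ ->; ring.
Qed.

(** The factor nu(4)^-1 of [poch_duplication], spread over the nu_i, becomes the division by 4 in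
    each argument. *)
Lemma FC_integral n a (b : 'I_n -> F -> algC) (lam : 'I_n -> F) : (2%:R : F) != 0 -> (0 < n)%N ->
  is_mchar a -> (forall i, is_mchar (b i)) ->
  FC psi a (cmul a (@qphi F)) (fun i => cmul (b i) (@qphi F)) (fun i => lam i ^+ 2)
  = - (g (cmul a a))^-1 * \sum_(x | x != 0) psi x * cmul a a x *
      \prod_i bessel (cmul (b i) (@qphi F)) ((lam i * x) ^+ 2 / 4%:R).
Proof.
move=> two n0 ha hb.
transitivity (- (g (cmul a a))^-1 * \sum_(x | x != 0) psi x * cmul a a x *
      \prod_i bessel (cmul (b i) (@qphi F)) (lam i ^+ 2 / 4%:R * x ^+ 2)); last first.
  congr (_ * _); apply: eq_bigr => x _; congr (_ * _); apply: eq_bigr => i _.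
  by rewrite exprMn mulrAC.
rewrite -(lauricella_integral _ (fun x => x ^+ 2) (fun i nu =>
  (pochc psi (cmul (b i) (@qphi F)) nu * pochc psi one nu)^-1)) /FC; congr (_ * _).
apply: eq_bigr => nu _.
have hN : is_mchar (Defs.cprod (fun i => mchar (nu i))).
  by apply: is_mchar_cprod => // i; apply: mchar_is_mchar.
rewrite poch_duplication // -!prodfV -mulrA -big_split /= [_ * poch _ _ _]mulrC -mulrA.
congr (_ * _); rewrite -big_split; apply: eq_bigr => i _ /=.
have hi := mchar_is_mchar (nu i); case: (hi) => _ _ hM.
rewrite (hM (lam i ^+ 2) 4%:R^-1) (is_mcharV _ hi) mulrCA; congr (_ * _); exact: mulrC.
Qed.

Lemma FA_integral n a (b : 'I_n -> F -> algC) (mu : 'I_n -> F) :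
  FA psi a b (fun i => cmul (b i) (b i)) mu
  = - (g a)^-1 * \sum_(x | x != 0) psi x * a x * \prod_i kummer (b i) (mu i * x).
Proof.
rewrite -(lauricella_integral _ id (fun i nu =>
  poch psi (b i) nu / (pochc psi (cmul (b i) (b i)) nu * pochc psi one nu))) /FA.
congr (_ * _); apply: eq_bigr => nu _.
rewrite -prodfV -!mulrA -!big_split /=; congr (_ * (_ * _)).
by apply: eq_bigr => i _; rewrite !mulrA.
Qed.

End GaussSums.

Theorem theorem3p9 (F : finFieldType) (psi : F -> algC) (hpsi : is_nontriv_addchar psi)
  (hp : (2%:R : F) != 0) (n : nat) (hn : (1 <= n)%N)
  (al : Iirr (Fx F)) (be : 'I_n -> Iirr (Fx F))
  (hbe : forall i, mchar (be i) <> @eps F)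
  (lam : 'I_n -> F) (hlam : \sum_(i < n) lam i != -1) :
  FC psi (mchar al) (cmul (mchar al) (@qphi F)) (fun i => cmul (mchar (be i)) (@qphi F))
     (fun i => lam i ^+ 2)
  = cinv (cmul (mchar al) (mchar al)) (1 + \sum_(i < n) lam i) *
    FA psi (cmul (mchar al) (mchar al)) (fun i => mchar (be i))
       (fun i => cmul (mchar (be i)) (mchar (be i)))
       (fun i => 2%:R * lam i / (1 + \sum_(j < n) lam j)).
Proof.
have [psiD psi_nontriv] := hpsi.
(* [is_nontriv_addchar] does not exclude the zero function, for which all Gauss
   sums vanish. *)
have [p0|pn0] := eqVneq (psi 0) 0.
  have g0 a : gauss psi a = 0.
    by rewrite /gauss big1 ?oppr0 // => x _; rewrite -[x]addr0 psiD p0 mulr0 mul0r.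
  have poch0 a nu : poch psi a nu = 0 by rewrite /poch g0 mul0r.
  transitivity (0 : algC); last symmetry.
    by rewrite /FC big1 ?mulr0 // => nu _; rewrite poch0 !mul0r.
  by rewrite /FA [X in _ * (_ * X)]big1 ?mulr0 // => nu _; rewrite poch0 !mul0r.
have psi0 : psi 0 = 1 by apply: (mulfI pn0); rewrite -psiD addr0 mulr1.
have ha := mchar_is_mchar al; have hb i := mchar_is_mchar (be i).
set s := 1 + _; have s0 : s != 0 by rewrite /s addrC addr_eq0.
have haa := is_mchar_cmul ha ha; have as0 := is_mchar_neq0 haa s0.
rewrite FC_integral // FA_integral // mulrCA; congr (_ * _).
(* The value of al^2 at s released by x -> s x cancels the prefactor. *)
rewrite [in RHS](reindex_inj (mulfI s0)) mulr_sumr /=.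
apply: eq_big => [x|x x0]; first by rewrite mulf_eq0 (negbTE s0).
case: (haa) => _ _ aM; rewrite aM {1}/cinv.
have -> : psi (s * x) = psi x * \prod_i psi (lam i * x).
  by rewrite mulrDl mul1r psiD mulr_suml (big_morph psi psiD psi0).
have -> : \prod_i bessel psi (cmul (mchar (be i)) (@qphi F)) ((lam i * x) ^+ 2 / 4%:R)
   = \prod_i psi (lam i * x) * \prod_i kummer psi (mchar (be i)) (2%:R * lam i / s * (s * x)).
  rewrite -big_split; apply: eq_bigr => i _ /=.
  (* Here s cancels the denominator in the arguments of [FA]. *)
  by rewrite -kummer_bessel //; congr (_ * kummer _ _ _); field.
by field.
Qed.
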